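(* Let $(R,\mathfrak m)$ be a one-dimensional Noetherian Cohen-Macaulay local ring with infinite residue field $k=R/\mathfrak m\subseteq R$. Let $I$ be a proper regular ideal of $R$, and let $x\in I$ be a minimal (principal) reduction of $I$. Let $U=k+I\subseteq R$, which is a local ring with maximal ideal $\mathfrak n=I$, and let $J=xR$, which is an ideal of $U$. Then $\mathrm{gr}_I(R)$ is isomorphic to $\mathrm{gr}_{\mathfrak n}(J)$, both as a $\mathrm{gr}_{\mathfrak n}(U)$-module and as a $\mathrm{gr}_I(R)$-module.
   Context: ''$k=R/\mathfrak m\subseteq R$'' means that $R$ contains a field $k$ mapped isomorphically onto the residue field $R/\mathfrak m$. An ideal is regular if it contains a non-zero-divisor. A principal reduction of $I$ is an element $x\in I$ (or the ideal $xR$) with $I^{n+1}=xI^n$ for some $n\ge 0$; in this setting minimal reductions of regular ideals are principal, and such an $x$ is a non-zero-divisor. The subring $U=k+I$ of $R$ is a one-dimensional Noetherian Cohen-Macaulay local ring with maximal ideal $\mathfrak n=I$. The associated graded objects are $\mathrm{gr}_I(R)=\bigoplus_{i\ge 0} I^i/I^{i+1}$, $\mathrm{gr}_{\mathfrak n}(U)=\bigoplus_{i\ge0}\mathfrak n^i/\mathfrak n^{i+1}$ (with $\mathfrak n^0=U$), and $\mathrm{gr}_{\mathfrak n}(J)=\bigoplus_{i\ge 0}\mathfrak n^iJ/\mathfrak n^{i+1}J$. Since $\mathfrak n^iJ=xI^i$ for all $i\ge0$ (with $I^0=R$), $\mathrm{gr}_{\mathfrak n}(J)$ is also naturally a $\mathrm{gr}_I(R)$-module;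 $\mathrm{gr}_I(R)$ is a $\mathrm{gr}_{\mathfrak n}(U)$-module via the inclusion $U\subseteq R$. *)

(* Defs.v *)
From HB Require Import structures.
From mathcomp Require Import all_boot all_order all_algebra.
From mathcomp Require Import boolp classical_sets functions cardinality.

Set Implicit Arguments.
Unset Strict Implicit.
Unset Printing Implicit Defensive.

Import GRing.Theory.
Local Open Scope classical_set_scope.
Local Open Scope ring_scope.

(* Subrings of R, and additive subgroups of R stable under a subring A. The   *)
(* A-modules that occur are all of the latter kind: A itself, its ideals, the *)
(* ideals of R, and R.                                                        *)
Record subring (R : comNzRingType) := Subring {
  subring_set :> set R;
  subring1 : subring_set 1;
  subringB : forall a b, subring_set a -> subring_set b -> subring_set (a - b);
  subringM : forall a b, subring_set a -> subring_set b -> subring_set (a * b) }.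

Record submod (R : comNzRingType) (A : subring R) := Submod {
  submod_set :> set R;
  submod0 : submod_set 0;
  submodD : forall u v, submod_set u -> submod_set v -> submod_set (u + v);
  submodZ : forall a u, (A : set R) a -> submod_set u -> submod_set (a * u) }.

Record ideal (R : comNzRingType) (A : subring R) := Ideal {
  ideal_submod :> submod A;
  ideal_sub : (ideal_submod : set R) `<=` A }.

Record subfield (R : comNzRingType) := Subfield {
  subfield_subring :> subring R;
  subfieldV : forall a, (subfield_subring : set R) a -> a != 0 ->
    exists2 b, (subfield_subring : set R) b & a * b = 1 }.

Definition whole (R : comNzRingType) : subring R :=
  @Subring R setT I (fun _ _ _ _ => I) (fun _ _ _ _ => I).

Section Rings.
Variable R : comNzRingType.
Implicit Types (A : subring R) (x y : R) (s : seq R).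

Lemma subring0 A : (A : set R) 0.
Proof. by rewrite -(subrr 1); apply: subringB; apply: subring1. Qed.

Lemma subringN A a : (A : set R) a -> (A : set R) (- a).
Proof. by move=> Aa; rewrite -sub0r; apply: subringB => //; apply: subring0. Qed.

Lemma subringD A a b : (A : set R) a -> (A : set R) b -> (A : set R) (a + b).
Proof.
by move=> Aa Ab; rewrite -[b]opprK; apply: subringB => //; apply: subringN.
Qed.

Lemma submodN A (M : submod A) u : (M : set R) u -> (M : set R) (- u).
Proof.
move=> Mu; rewrite -mulN1r; apply: submodZ => //.
exact/subringN/subring1.
Qed.

Definition self A : ideal A :=
  @Ideal R A (@Submod R A A (subring0 A) (@subringD A) (@subringM R A))
    (@subset_refl _ A).

(* An ideal of R, viewed as an A-module through the inclusion of A in R.      *)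
Definition restr A (M : submod (whole R)) : submod A :=
  @Submod R A M (submod0 M) (@submodD R _ M) (fun a u _ => @submodZ R _ M a u I).

Definition principal_set x : set R := range ( *%R x).

Lemma principal_set0 x : principal_set x 0.
Proof. by exists 0; rewrite ?mulr0. Qed.

Lemma principal_setD x u v :
  principal_set x u -> principal_set x v -> principal_set x (u + v).
Proof. by move=> [a _ <-] [b _ <-]; exists (a + b); rewrite ?mulrDr. Qed.

Lemma principal_setZ x a u :
  (whole R : set R) a -> principal_set x u -> principal_set x (a * u).
Proof. by move=> _ [b _ <-]; exists (a * b); rewrite // mulrCA. Qed.

Definition principal x : ideal (whole R) :=
  @Ideal R (whole R) (@Submod R (whole R) (principal_set x)
    (principal_set0 x) (@principal_setD x) (@principal_setZ x))
    (@subsetT _ (principal_set x)).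

Definition nonzerodivisor x := forall y, x * y = 0 -> y = 0.

Definition regular_ideal (I : ideal (whole R)) :=
  exists2 x, (I : set R) x & nonzerodivisor x.

Definition maximal A (m : ideal A) :=
  ~ (m : set R) 1 /\
  forall b : ideal A, (m : set R) `<=` b -> ~ (b : set R) 1 -> (b : set R) `<=` m.

Definition local_ring A (m : ideal A) :=
  maximal m /\ forall b : ideal A, maximal b -> b = m :> set R.

Definition span s : set R :=
  [set r | exists c : nat -> R, r = \sum_(i < size s) c i * s`_i].

Definition noetherian :=
  forall I : ideal (whole R), exists s, I = span s :> set R.

Definition prime_ideal (P : ideal (whole R)) :=
  ~ (P : set R) 1 /\
  forall x y, (P : set R) (x * y) -> (P : set R) x \/ (P : set R) y.

Definition prime_chain (d : nat) (P : nat -> ideal (whole R)) :=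
  (forall i, (i <= d)%N -> prime_ideal (P i)) /\
  (forall i, (i < d)%N -> (P i : set R) `<` P i.+1).

Definition krull_dim (d : nat) :=
  (exists P, prime_chain d P) /\ (forall e P, prime_chain e P -> (e <= d)%N).

Definition regular_sequence s :=
  ~ span s 1 /\
  forall i, (i < size s)%N ->
    forall r, span (take i s) (s`_i * r) -> span (take i s) r.

Definition depth (m : ideal (whole R)) (d : nat) :=
  (exists2 s, regular_sequence s & {in s, forall y, (m : set R) y} /\ size s = d)
  /\ (forall s, regular_sequence s -> {in s, forall y, (m : set R) y} ->
      (size s <= d)%N).

(* The definition used for a Noetherian local ring with maximal ideal m.      *)
Definition cohen_macaulay (m : ideal (whole R)) :=
  exists d, krull_dim d /\ depth m d.

End Rings.

Section Filtration.
Variable R : comNzRingType.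
Implicit Types (A : subring R) (S T : set R).

Definition coset S r : set R := [set y | S (y - r)].

Definition residue_field (m : ideal (whole R)) : set (set R) := range (coset m).

Definition setprod S T : set R :=
  [set r | exists2 s : seq (R * R), (forall p, p \in s -> S p.1 /\ T p.2) &
           r = \sum_(p <- s) p.1 * p.2].

(* powmod S M i is S^i M; for an ideal I of R, powmod I (whole R) i is I^i.   *)
Fixpoint powmod S T (i : nat) : set R :=
  if i is j.+1 then setprod S (powmod S T j) else T.

Definition reduction (K I : ideal (whole R)) :=
  (K : set R) `<=` I /\
  exists n, powmod I (whole R) n.+1 = setprod K (powmod I (whole R) n).

Definition minimal_reduction (K I : ideal (whole R)) :=
  reduction K I /\
  forall K' : ideal (whole R),
    reduction K' I -> (K' : set R) `<=` K -> K' = K :> set R.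

Lemma coset_eq S : S 0 -> (forall u v, S u -> S v -> S (u - v)) ->
  forall a b, coset S a = coset S b <-> S (a - b).
Proof.
move=> S0 SB a b; split=> [E|Sab].
  have : coset S a a by rewrite /coset /= subrr.
  by rewrite E.
apply/seteqP; split=> y /= Sy; rewrite /coset /=.
  have -> : y - b = (y - a) - (0 - (a - b)) by rewrite sub0r opprK addrA subrK.
  by apply: (SB) => //; apply: (SB).
have -> : y - a = (y - b) - (a - b) by rewrite opprB addrA subrK.
exact: SB.
Qed.

Section Powmod.
Variables (A : subring R) (a : ideal A) (M : submod A).
Local Notation F := (powmod a M).

Lemma powmod0 i : F i 0.
Proof.
case: i => [|i]; first exact: submod0.
by exists [::] => //; rewrite big_nil.
Qed.

Lemma powmodD i u v : F i u -> F i v -> F i (u + v).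
Proof.
case: i => [|i]; first exact: submodD.
move=> [s hs ->] [t ht ->]; exists (s ++ t); last by rewrite big_cat.
by move=> p; rewrite mem_cat => /orP[/hs|/ht].
Qed.

Lemma powmodZ i c u : (A : set R) c -> F i u -> F i (c * u).
Proof.
move=> Ac; case: i => [|i]; first exact: submodZ.
move=> [s hs ->]; exists [seq (c * p.1, p.2) | p <- s].
  by move=> p /mapP[q /hs[aq Fq] ->] /=; split=> //; apply: submodZ.
by rewrite big_map mulr_sumr; apply: eq_bigr => p _; rewrite mulrA.
Qed.

Lemma powmodN i u : F i u -> F i (- u).
Proof.
by move=> Fu; rewrite -mulN1r; apply: powmodZ => //; apply/subringN/subring1.
Qed.

Lemma powmodB i u v : F i u -> F i v -> F i (u - v).
Proof. by move=> Fu Fv; apply: powmodD => //; apply: powmodN. Qed.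

Lemma powmodS i : F i.+1 `<=` F i.
Proof.
move=> _ [s hs ->]; rewrite big_seq.
elim/big_ind: _; [exact: powmod0|exact: powmodD|].
by move=> p /hs[ap Fp]; apply: powmodZ => //; apply: ideal_sub ap.
Qed.

Lemma powmod_sum i n (G : nat -> R) :
  (forall j, (j < n)%N -> F i (G j)) -> F i (\sum_(j < n) G j).
Proof.
move=> FG; elim/big_ind: _; [exact: powmod0|exact: powmodD|].
by move=> j _; apply: FG.
Qed.

Lemma coset_powmod i r t : coset (F i.+1) r = coset (F i.+1) t <-> F i.+1 (r - t).
Proof. by apply: coset_eq; [exact: powmod0|exact: powmodB]. Qed.

End Powmod.

Lemma powmodM A (a : ideal A) (M : submod A) i j u v :
  powmod a (self A) i u -> powmod a M j v -> powmod a M (i + j) (u * v).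
Proof.
elim: i u => [|i IH] u; first by move=> Au; apply: powmodZ.
move=> [s hs ->] Fv; rewrite mulr_suml big_seq.
elim/big_ind: _; [exact: powmod0|exact: powmodD|].
move=> p /hs[ap Fp]; rewrite -mulrA addSn.
exists [:: (p.1, p.2 * v)]; last by rewrite big_seq1.
by move=> q; rewrite inE => /eqP -> /=; split=> //; apply: IH.
Qed.

End Filtration.

(* The direct sum of the F i / F i.+1: families of cosets, almost all zero.   *)
Record gr (R : comNzRingType) (F : nat -> set R) := Gr {
  gr_fun :> nat -> set R;
  grP : forall i, exists2 r, F i r & gr_fun i = coset (F i.+1) r;
  gr_fin : exists N, forall i, (N <= i)%N -> gr_fun i = coset (F i.+1) 0 }.

Definition homogeneous (R : comNzRingType) (F : nat -> set R)
    (i : nat) (u : gr F) :=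
  forall j, j != i -> u j = coset (F j.+1) 0.

Definition rep (R : comNzRingType) (F : nat -> set R) (u : gr F) i : R :=
  xget 0 [set r | F i r /\ u i = coset (F i.+1) r].

(* grmod a M is gr_a(M), the direct sum of the a^i M / a^(i+1) M, with its    *)
(* structure of module over gr_a(A); the underlying type does not depend on   *)
(* A, only on the sets a and M.                                               *)
Definition grmod (R : comNzRingType) (A : subring R) (a : ideal A)
  (M : submod A) : Type := gr (powmod a M).

Definition grring (R : comNzRingType) (A : subring R) (a : ideal A) : Type :=
  grmod a (self A).

Section GradedModule.
Variables (R : comNzRingType) (A : subring R) (a : ideal A).

Section Module.
Variable M : submod A.
Local Notation F := (powmod a M).
Implicit Types (u v : grmod a M) (P Q : {poly R}).

Lemma gr_eqP u v : (forall i, u i = v i) -> u = v.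
Proof.
move=> uv; have E : gr_fun u = gr_fun v by apply/funext.
case: u v E {uv} => [u hu fu] [v hv fv] /= E; subst v.
by congr Gr; apply: Prop_irrelevance.
Qed.

Lemma repP u i : F i (rep u i) /\ u i = coset (F i.+1) (rep u i).
Proof.
rewrite /rep; case: xgetP => [r _ //|h].
by have [r Fr ur] := grP u i; case: (h r).
Qed.

Lemma cls_grP (P : {poly R}) : (forall i, F i P`_i) ->
  forall i, exists2 r, F i r & coset (F i.+1) P`_i = coset (F i.+1) r.
Proof. by move=> h i; exists P`_i. Qed.

Lemma cls_gr_fin (P : {poly R}) :
  exists N, forall i, (N <= i)%N -> coset (F i.+1) P`_i = coset (F i.+1) 0.
Proof. by exists (size P) => i hi; rewrite nth_default. Qed.

Definition cls P (FP : forall i, F i P`_i) : grmod a M :=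
  Gr (cls_grP FP) (cls_gr_fin P).

Lemma cls_eqP P Q (FP : forall i, F i P`_i) (FQ : forall i, F i Q`_i) :
  (forall i, F i.+1 (P`_i - Q`_i)) -> cls FP = cls FQ.
Proof. by move=> h; apply: gr_eqP => i /=; apply/coset_powmod/h. Qed.

Lemma eq_cls P Q (FP : forall i, F i P`_i) (FQ : forall i, F i Q`_i) :
  P = Q -> cls FP = cls FQ.
Proof. by move=> PQ; apply: cls_eqP => i; rewrite PQ subrr; apply: powmod0. Qed.

Lemma rep_cls P (FP : forall i, F i P`_i) i : F i.+1 (rep (cls FP) i - P`_i).
Proof. by apply/coset_powmod; have [_ /= <-] := repP (cls FP) i. Qed.

Lemma clsP u : exists P (FP : forall i, F i P`_i), u = cls FP.
Proof.
have [N hN] := gr_fin u.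
pose P := \poly_(i < N) rep u i.
have FP i : F i P`_i.
  by rewrite coef_poly; case: ifP => _; [have [] := repP u i|apply: powmod0].
exists P, FP; apply: gr_eqP => i /=; rewrite coef_poly.
by case: ltnP => [_|/hN //]; have [] := repP u i.
Qed.

Lemma zero_coef i : F i (0 : {poly R})`_i.
Proof. by rewrite coef0; apply: powmod0. Qed.

Definition gr_zero : grmod a M := cls zero_coef.

Lemma opp_grP u i : exists2 r, F i r &
  coset (F i.+1) (- rep u i) = coset (F i.+1) r.
Proof. by exists (- rep u i) => //; apply: powmodN; have [] := repP u i. Qed.

Lemma opp_gr_fin u : exists N, forall i, (N <= i)%N ->
  coset (F i.+1) (- rep u i) = coset (F i.+1) 0.
Proof.
have [N hN] := gr_fin u; exists N => i /hN ui; apply/coset_powmod.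
rewrite -opprD addr0; apply: powmodN.
by rewrite -[rep u i]subr0; apply/coset_powmod; rewrite -ui; have [_ <-] := repP u i.
Qed.

Definition gr_opp u : grmod a M := Gr (opp_grP u) (opp_gr_fin u).

Lemma add_grP u v i : exists2 r, F i r &
  coset (F i.+1) (rep u i + rep v i) = coset (F i.+1) r.
Proof.
exists (rep u i + rep v i) => //.
by apply: powmodD; [have [] := repP u i|have [] := repP v i].
Qed.

Lemma rep_small u : exists N, forall i, (N <= i)%N -> F i.+1 (rep u i).
Proof.
have [N hN] := gr_fin u; exists N => i /hN ui.
by rewrite -[rep u i]subr0; apply/coset_powmod; rewrite -ui; have [_ <-] := repP u i.
Qed.

Lemma add_gr_fin u v : exists N, forall i, (N <= i)%N ->
  coset (F i.+1) (rep u i + rep v i) = coset (F i.+1) 0.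
Proof.
have [[N hN] [N' hN']] := (rep_small u, rep_small v).
exists (maxn N N') => i; rewrite geq_max => /andP[/hN hu /hN' hv].
by apply/coset_powmod; rewrite subr0; apply: powmodD.
Qed.

Definition gr_add u v : grmod a M := Gr (add_grP u v) (add_gr_fin u v).

Lemma gr_opp_cls P (FP : forall i, F i P`_i) (FN : forall i, F i (- P)`_i) :
  gr_opp (cls FP) = cls FN.
Proof.
apply: gr_eqP => i /=; apply/coset_powmod; rewrite coefN -opprD.
exact/powmodN/rep_cls.
Qed.

Lemma gr_add_cls P Q (FP : forall i, F i P`_i) (FQ : forall i, F i Q`_i)
    (FD : forall i, F i (P + Q)`_i) : gr_add (cls FP) (cls FQ) = cls FD.
Proof.
apply: gr_eqP => i /=; apply/coset_powmod; rewrite coefD opprD addrACA.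
by apply: powmodD; apply: rep_cls.
Qed.

Lemma add_coef P Q : (forall i, F i P`_i) -> (forall i, F i Q`_i) ->
  forall i, F i (P + Q)`_i.
Proof. by move=> FP FQ i; rewrite coefD; apply: powmodD. Qed.

Lemma opp_coef P : (forall i, F i P`_i) -> forall i, F i (- P)`_i.
Proof. by move=> FP i; rewrite coefN; apply: powmodN. Qed.

Lemma gr_addA : associative gr_add.
Proof.
move=> u v w; have [P [FP ->]] := clsP u; have [Q [FQ ->]] := clsP v.
have [T [FT ->]] := clsP w.
rewrite (gr_add_cls FQ FT (add_coef FQ FT)) (gr_add_cls FP FQ (add_coef FP FQ)).
rewrite (gr_add_cls FP _ (add_coef FP (add_coef FQ FT))).
rewrite (gr_add_cls _ FT (add_coef (add_coef FP FQ) FT)).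
exact/eq_cls/addrA.
Qed.

Lemma gr_addC : commutative gr_add.
Proof.
by move=> u v; apply: gr_eqP => i /=; rewrite addrC.
Qed.

Lemma gr_add0 : left_id gr_zero gr_add.
Proof.
move=> u; have [P [FP ->]] := clsP u.
by rewrite (gr_add_cls _ FP (add_coef zero_coef FP)); apply/eq_cls/add0r.
Qed.

Lemma gr_addN : left_inverse gr_zero gr_opp gr_add.
Proof.
move=> u; have [P [FP ->]] := clsP u.
rewrite (gr_opp_cls FP (opp_coef FP)).
rewrite (gr_add_cls _ FP (add_coef (opp_coef FP) FP)).
exact/eq_cls/addNr.
Qed.

HB.instance Definition _ := gen_eqMixin (grmod a M).
HB.instance Definition _ := gen_choiceMixin (grmod a M).
HB.instance Definition _ :=
  GRing.isZmodule.Build (grmod a M) gr_addA gr_addC gr_add0 gr_addN.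

End Module.

(* (r + a^(i+1)) (s + a^(j+1) M) = r s + a^(i+j+1) M, extended bilinearly.    *)
Definition gr_prod (M : submod A) (p : grring a) (u : grmod a M) (n : nat) : R :=
  \sum_(i < n.+1) rep p i * rep u (n - i).

Section Scale.
Variable M : submod A.
Local Notation FA := (powmod a (self A)).
Local Notation F := (powmod a M).
Implicit Types (p q : grring a) (u v : grmod a M) (P Q : {poly R}).

Lemma coefM_powmod P Q : (forall i, FA i P`_i) -> (forall i, F i Q`_i) ->
  forall i, F i (P * Q)`_i.
Proof.
move=> FP FQ n; rewrite coefM.
apply: (powmod_sum (G := fun i => P`_i * Q`_(n - i))) => i.
by rewrite ltnS => hi; rewrite -[X in F X](subnKC hi); apply: powmodM.
Qed.

Lemma gr_prod_cls P Q (FP : forall i, FA i P`_i) (FQ : forall i, F i Q`_i) n :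
  F n.+1 (gr_prod (cls FP : grring a) (cls FQ) n - (P * Q)`_n).
Proof.
rewrite /gr_prod; set f := rep _; set g := rep _; rewrite coefM -sumrB.
apply: (powmod_sum (G := fun i => f i * g (n - i)%N - P`_i * Q`_(n - i))) => i.
rewrite ltnS => hi.
have -> : f i * g (n - i)%N - P`_i * Q`_(n - i) =
    (f i - P`_i) * g (n - i)%N + P`_i * (g (n - i)%N - Q`_(n - i)).
  by rewrite mulrBl mulrBr addrA subrK.
apply: powmodD; rewrite -[X in F X.+1](subnKC hi); last first.
  by rewrite -addnS; apply: powmodM => //; apply: rep_cls.
rewrite -addSn; apply: powmodM; first exact: rep_cls.
by have [] := repP (cls FQ) (n - i)%N.
Qed.

Lemma scale_grP p u i : exists2 r, F i r &
  coset (F i.+1) (gr_prod p u i) = coset (F i.+1) r.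
Proof.
exists (gr_prod p u i) => //.
apply: (powmod_sum (G := fun j => rep p j * rep u (i - j))) => j.
rewrite ltnS => hj; rewrite -[X in F X](subnKC hj); apply: powmodM.
  by have [] := @repP (self A) p j.
by have [] := repP u (i - j).
Qed.

Lemma scale_gr_fin p u : exists N, forall i, (N <= i)%N ->
  coset (F i.+1) (gr_prod p u i) = coset (F i.+1) 0.
Proof.
have [P [FP ->]] := clsP p; have [Q [FQ ->]] := clsP u.
exists (size (P * Q)) => i hi; apply/coset_powmod.
by have := gr_prod_cls FP FQ i; rewrite nth_default.
Qed.

Definition gr_scale p u : grmod a M := Gr (scale_grP p u) (scale_gr_fin p u).

Lemma gr_scale_cls P Q (FP : forall i, FA i P`_i) (FQ : forall i, F i Q`_i)
    (FM : forall i, F i (P * Q)`_i) : gr_scale (cls FP) (cls FQ) = cls FM.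
Proof. by apply: gr_eqP => i /=; apply/coset_powmod/gr_prod_cls. Qed.

End Scale.

Lemma one_coef i : powmod a (self A) i (1 : {poly R})`_i.
Proof.
rewrite coef1; case: i => [|i]; [exact: subring1|exact: powmod0].
Qed.

Definition gr_one : grring a := cls one_coef.

Lemma gr_scaleA (M : submod A) (p q : grring a) (u : grmod a M) :
  gr_scale p (gr_scale q u) = gr_scale (gr_scale p q : grring a) u.
Proof.
have [P [FP ->]] := clsP p; have [Q [FQ ->]] := clsP q.
have [T [FT ->]] := clsP u.
rewrite (gr_scale_cls FQ FT (coefM_powmod FQ FT)).
rewrite (gr_scale_cls FP _ (coefM_powmod FP (coefM_powmod FQ FT))).
rewrite (gr_scale_cls FP FQ (coefM_powmod FP FQ)).
rewrite (gr_scale_cls _ FT (coefM_powmod (coefM_powmod FP FQ) FT)).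
exact/eq_cls/mulrA.
Qed.

Lemma gr_scale1 (M : submod A) (u : grmod a M) : gr_scale gr_one u = u.
Proof.
have [P [FP ->]] := clsP u.
by rewrite (gr_scale_cls one_coef FP (coefM_powmod one_coef FP));
  apply/eq_cls/mul1r.
Qed.

Lemma gr_scaleDl (M : submod A) (p q : grring a) (u : grmod a M) :
  gr_scale (p + q) u = gr_scale p u + gr_scale q u.
Proof.
have [P [FP ->]] := clsP p; have [Q [FQ ->]] := clsP q.
have [T [FT ->]] := clsP u.
rewrite [_ + _ in LHS](gr_add_cls FP FQ (add_coef FP FQ)).
rewrite (gr_scale_cls _ FT (coefM_powmod (add_coef FP FQ) FT)).
rewrite (gr_scale_cls FP FT (coefM_powmod FP FT)).
rewrite (gr_scale_cls FQ FT (coefM_powmod FQ FT)).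
rewrite [RHS](gr_add_cls _ _ (add_coef (coefM_powmod FP FT) (coefM_powmod FQ FT))).
exact/eq_cls/mulrDl.
Qed.

Lemma gr_scaleDr (M : submod A) (p : grring a) (u v : grmod a M) :
  gr_scale p (u + v) = gr_scale p u + gr_scale p v.
Proof.
have [P [FP ->]] := clsP p; have [Q [FQ ->]] := clsP u.
have [T [FT ->]] := clsP v.
rewrite [_ + _ in LHS](gr_add_cls FQ FT (add_coef FQ FT)).
rewrite (gr_scale_cls FP _ (coefM_powmod FP (add_coef FQ FT))).
rewrite (gr_scale_cls FP FQ (coefM_powmod FP FQ)).
rewrite (gr_scale_cls FP FT (coefM_powmod FP FT)).
rewrite [RHS](gr_add_cls _ _ (add_coef (coefM_powmod FP FQ) (coefM_powmod FP FT))).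
exact/eq_cls/mulrDr.
Qed.

Definition gr_mul (p q : grring a) : grring a := gr_scale p q.

Lemma gr_mulC : commutative gr_mul.
Proof.
move=> p q; have [P [FP ->]] := clsP p; have [Q [FQ ->]] := clsP q.
rewrite /gr_mul (gr_scale_cls FP FQ (coefM_powmod FP FQ)).
by rewrite (gr_scale_cls FQ FP (coefM_powmod FQ FP)); apply/eq_cls/mulrC.
Qed.

HB.instance Definition _ := GRing.Zmodule.on (grring a).
HB.instance Definition _ := GRing.Zmodule_isComPzRing.Build (grring a)
  (@gr_scaleA (self A)) gr_mulC (@gr_scale1 (self A)) (@gr_scaleDl (self A)).
HB.instance Definition _ (M : submod A) :=
  GRing.Zmodule_isLmodule.Build (grring a) (grmod a M)
    (@gr_scaleA M) (@gr_scale1 M) (@gr_scaleDr M)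
    (fun u p q => @gr_scaleDl M p q u).

End GradedModule.

Lemma exists_maximal (R : comNzRingType) (b : ideal (whole R)) :
  ~ (b : set R) 1 ->
  exists2 m : ideal (whole R), maximal m & (b : set R) `<=` m.
Proof.
move=> b1.
pose P (X : set R) :=
  ~ X 1 /\ exists c : ideal (whole R), X `|` b = c :> set R.
have [F FP Ftot|X [[X1 [c Xc]] Xmax]] := Zorn_bigcup (P := P).
  pose G := \bigcup_(X in F) X `|` b.
  have XG X : F X -> X `|` b `<=` G.
    by move=> FX w [Xw|bw]; [left; exists X|right].
  have G0 : G 0 by right; apply: submod0.
  have GD u v : G u -> G v -> G (u + v).
    have FD X : F X -> (X `|` b) u -> (X `|` b) v -> G (u + v).
      move=> FX Xu Xv; apply: (XG X FX); have [_ [c Xc]] := FP X FX.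
      by move: Xu Xv; rewrite Xc; apply: submodD.
    move=> [[X FX Xu]|bu] [[Y FY Yv]|bv].
    - have [XY|YX] := Ftot X Y FX FY.
        by apply: (FD Y) => //; left => //; apply: XY.
      by apply: (FD X) => //; left => //; apply: YX.
    - by apply: (FD X) => //; [left|right].
    - by apply: (FD Y) => //; [right|left].
    - by right; apply: submodD.
  have GZ r u : (whole R : set R) r -> G u -> G (r * u).
    move=> _ [[X FX Xu]|bu]; last by right; apply: submodZ.
    apply: (XG X FX); have [_ [c Xc]] := FP X FX.
    by rewrite Xc; apply: submodZ => //; rewrite -Xc; left.
  split; first by move=> [X FX X1]; have [] := FP X FX.
  by exists (@Ideal R (whole R) (@Submod R (whole R) G G0 GD GZ) (@subsetT _ G)).
exists c; last by rewrite -Xc; apply: subsetUr.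
split=> [|d cd d1].
  by rewrite -Xc => -[/X1|/b1].
move=> y dy; apply: contrapT => cy; apply: (Xmax d).
  split=> [z Xz|dX]; first by apply: cd; rewrite -Xc; left.
  by apply: cy; rewrite -Xc; left; apply: dX.
split=> //; exists d; apply: setUidl => z bz; apply: cd.
by rewrite -Xc; right.
Qed.

Lemma proper_sub_local (R : comNzRingType) (m b : ideal (whole R)) :
  local_ring m -> ~ (b : set R) 1 -> (b : set R) `<=` m.
Proof.
by move=> [_ muniq] /exists_maximal[m' /muniq <-].
Qed.

Section CoefficientField.
Variables (R : comNzRingType) (k : subfield R) (I : ideal (whole R)).

Definition coef_set : set R := [set c + z | c in (k : set R) & z in (I : set R)].

Lemma coef_set1 : coef_set 1.
Proof.
by exists 1; [exact: subring1|exists 0; [exact: submod0|rewrite addr0]].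
Qed.

Lemma coef_setB u v : coef_set u -> coef_set v -> coef_set (u - v).
Proof.
move=> [c kc [z Iz <-]] [d kd [t It <-]]; exists (c - d); first exact: subringB.
exists (z - t); last by rewrite opprD addrACA.
by apply: submodD => //; apply: submodN.
Qed.

Lemma coef_setM u v : coef_set u -> coef_set v -> coef_set (u * v).
Proof.
move=> [c kc [z Iz <-]] [d kd [t It <-]]; exists (c * d); first exact: subringM.
exists (c * t + d * z + z * t); last first.
  by rewrite mulrDl !mulrDr -!addrA [d * z]mulrC.
by do 2?apply: submodD; apply: submodZ.
Qed.

Definition coef_subring : subring R := Subring coef_set1 coef_setB coef_setM.

Lemma coef_ideal_sub : (I : set R) `<=` coef_subring.
Proof.
by move=> z Iz; exists 0; [exact: subring0|exists z; rewrite ?add0r].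
Qed.

Definition coef_ideal : ideal coef_subring :=
  @Ideal R coef_subring (restr coef_subring I) coef_ideal_sub.

Lemma coef_local (m : ideal (whole R)) :
  local_ring m -> ~ (I : set R) 1 -> local_ring coef_ideal.
Proof.
move=> mloc I1; have Im := proper_sub_local mloc I1.
have inI (b : ideal coef_subring) : ~ (b : set R) 1 ->
    (forall y, (I : set R) y -> ~ (b : set R) (1 + y)) ->
    (b : set R) `<=` coef_ideal.
  move=> b1 bI v bv; have [c kc [z Iz cz]] := ideal_sub bv.
  have [c0|/(subfieldV kc)[d kd cd]] := eqVneq c 0.
    by move: cz; rewrite c0 add0r => <-.
  case: (bI (d * z)); first exact: submodZ.
  have -> : 1 + d * z = d * v by rewrite -cz mulrDr [d * c]mulrC cd.
  apply: submodZ => //; exists d => //.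
  by exists 0; rewrite ?addr0 //; apply: submod0.
have bunit (b : ideal coef_subring) : ~ (b : set R) 1 ->
    forall y, (I : set R) y -> ~ (b : set R) (1 + y).
  move=> b1 y Iy b1y; have [[r _ yr]|np] := pselect (principal_set (1 + y) 1).
    apply: b1; rewrite -yr mulrC; apply: submodZ => //.
    have -> : r = 1 - y * r by rewrite -yr mulrDl mul1r addrK.
    exists 1; first exact: subring1.
    exists (- (y * r)) => //; apply: submodN; rewrite mulrC; exact: submodZ.
  case: (mloc) => -[m1 _] _; apply: m1.
  rewrite -[1](addrK y); apply: submodD; last by apply: submodN; apply: Im.
  apply: (proper_sub_local mloc (b := principal (1 + y)) np).
  by exists 1; rewrite ?mulr1.
split; first by split=> // b _ b1; apply: inI b1 (bunit b b1).
move=> b [b1 bmax]; have bI := inI b b1 (bunit b b1).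
by apply/seteqP; split=> //; apply: bmax.
Qed.

End CoefficientField.

(* Main.v *)
Require Import Defs.
From mathcomp Require Import all_boot all_order all_algebra.
From mathcomp Require Import boolp classical_sets functions cardinality.
Import GRing.Theory.
Local Open Scope classical_set_scope.
Local Open Scope ring_scope.

(** The isomorphism is induced by multiplication by x, which sends I^i onto
    x I^i = n^i J.  It is injective on the graded pieces because x is a
    non-zero-divisor: if y is a non-zero-divisor in I and I^(n+1) = x I^n,
    then x divides y^(n+1). *)

Section MultiplicationMap.
Variables (R : comNzRingType) (A : subring R) (a : ideal A) (M N : submod A).
Variable x : R.
Local Notation F := (powmod a M).
Local Notation G := (powmod a N).
Hypothesis xFG : forall i r, F i r -> G i (x * r).

Lemma gr_mulx_subproof (u : grmod a M) i : exists2 r, G i r &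
  coset (G i.+1) (x * rep u i) = coset (G i.+1) r.
Proof. by exists (x * rep u i) => //; apply: xFG; have [] := repP u i. Qed.

Lemma gr_mulx_fin (u : grmod a M) : exists B, forall i, (B <= i)%N ->
  coset (G i.+1) (x * rep u i) = coset (G i.+1) 0.
Proof.
have [B hB] := rep_small u; exists B => i /hB ui; apply/coset_powmod.
by rewrite subr0; apply: xFG.
Qed.

Definition gr_mulx (u : grmod a M) : grmod a N :=
  Gr (gr_mulx_subproof u) (gr_mulx_fin u).

Lemma mulx_coef (P : {poly R}) :
  (forall i, F i P`_i) -> forall i, G i (x *: P)`_i.
Proof. by move=> FP i; rewrite coefZ; apply: xFG. Qed.

(* f is characterised by its values, rather than taken to be gr_mulx, so that
   the lemmas below apply to one map viewed over two different subrings A. *)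
Variable f : grmod a M -> grmod a N.
Hypothesis fE : forall u i, f u i = coset (G i.+1) (x * rep u i).

(** The choice of representatives is immaterial: changing one by an element of [F i.+1] changes its
    multiple by [x] within [G i.+1]. On polynomial lifts the map is thus scaling by [x]. *)
Lemma gr_mulx_cls (P : {poly R}) (FP : forall i, F i P`_i) :
  f (cls FP) = cls (mulx_coef _ FP).
Proof.
apply: gr_eqP => i; rewrite fE /=; apply/coset_powmod.
by rewrite coefZ -mulrBr; apply/xFG/rep_cls.
Qed.

(** After lifting to polynomials, this is the identity x(PQ + T) = P(xQ) + xT in R[X]. *)
Lemma gr_mulx_linear : linear f.
Proof.
move=> p u v; have [P [FP ->]] := clsP p; have [Q [FQ ->]] := clsP u.
have [T [FT ->]] := clsP v.
rewrite [_ *: _ in LHS](gr_scale_cls FP FQ (coefM_powmod FP FQ)).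
rewrite [_ + _ in LHS](gr_add_cls _ FT (add_coef (coefM_powmod FP FQ) FT)).
rewrite !gr_mulx_cls.
set Fx := mulx_coef Q FQ.
rewrite [_ *: _ in RHS](gr_scale_cls FP Fx (coefM_powmod FP Fx)).
rewrite [RHS](gr_add_cls _ _
  (add_coef (coefM_powmod FP Fx) (mulx_coef _ FT))).
by apply/eq_cls; rewrite scalerDr scalerAr.
Qed.

Lemma gr_mulx_homogeneous i (u : grmod a M) :
  homogeneous i u -> homogeneous i (f u).
Proof.
move=> hu j ji; rewrite fE; apply/coset_powmod.
(* The representative of a zero component need not be 0; it is only known to lie in [F j.+1]. *)
rewrite subr0; apply: xFG; rewrite -[rep u j]subr0; apply/coset_powmod.
by rewrite -hu //; have [_ <-] := repP u j.
Qed.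

(** The divisibility hypothesis is applied one degree up: if x(r - t) lies in [G i.+1], it equals x
    s with s in [F i.+1], and cancelling x gives r - t = s. *)
Lemma gr_mulx_inj :
  nonzerodivisor x -> (forall i w, G i w -> exists2 r, F i r & w = x * r) ->
  injective f.
Proof.
move=> xreg GxF u v fuv; apply: gr_eqP => i.
have [_ ->] := repP u i; have [_ ->] := repP v i; apply/coset_powmod.
have /coset_powmod : coset (G i.+1) (x * rep u i) = coset (G i.+1) (x * rep v i).
  by rewrite -!fE fuv.
rewrite -mulrBr => /GxF[r Fr /eqP]; rewrite -subr_eq0 -mulrBr => /eqP/xreg.
by move/eqP; rewrite subr_eq0 => /eqP ->.
Qed.

Lemma gr_mulx_surj :
  (forall i w, G i w -> exists2 r, F i r & w = x * r) ->
  forall v, exists u, f u = v.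
Proof.
move=> GxF v; have [P [GP ->]] := clsP v.
have /choice[c hc] i : exists r, F i r /\ P`_i = x * r.
  by have [r] := GxF i _ (GP i); exists r.
(* The quotients [c i] may be nonzero for all i; they are cut off at [size P], beyond which the
   coefficients of [P] vanish anyway. *)
pose Q := \poly_(i < size P) c i.
have FQ i : F i Q`_i.
  by rewrite coef_poly; case: ifP => _; [have [] := hc i|apply: powmod0].
exists (cls FQ); rewrite gr_mulx_cls; apply: eq_cls; apply/polyP => i.
rewrite coefZ coef_poly; case: ltnP => [_|iP]; first by have [_ ->] := hc i.
by rewrite mulr0 nth_default.
Qed.

Lemma gr_mulx_bij :
  nonzerodivisor x -> (forall i w, G i w -> exists2 r, F i r & w = x * r) ->
  bijective f.
Proof.
move=> xreg GxF; rewrite -setTT_bijective; split=> // [u v _ _|v _].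
  exact: gr_mulx_inj.
by have [u <-] := gr_mulx_surj GxF v; exists u.
Qed.

End MultiplicationMap.

Section PrincipalReduction.
Variables (R : comNzRingType) (I : ideal (whole R)) (x : R).

Lemma powmod_mulx i r :
  powmod I (self (whole R)) i r -> powmod I (principal x) i (x * r).
Proof.
elim: i r => [|i IH] r /=; first by exists r.
move=> [s hs ->]; exists [seq (p.1, x * p.2) | p <- s].
  by move=> p /mapP[q /hs[Iq Fq] ->] /=; split=> //; apply: IH.
by rewrite big_map mulr_sumr; apply: eq_bigr => p _; rewrite mulrCA.
Qed.

(** By commutativity x factors out of every summand; together with [powmod_mulx] this gives I^i (xR)
    = x I^i. *)
Lemma powmod_principal i w : powmod I (principal x) i w ->
  exists2 r, powmod I (self (whole R)) i r & w = x * r.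
Proof.
elim: i w => [|i IH] w /=; first by move=> [r _ <-]; exists r.
move=> [s hs ->]; rewrite big_seq.
elim/big_ind: _ => [|_ _ [r Fr ->] [t Ft ->]|p /hs[Ip /IH[r Fr ->]]].
- by exists 0; [exact: (powmod0 I (self (whole R)) i.+1)|rewrite mulr0].
- by exists (r + t); [exact: (@powmodD _ _ I (self (whole R)) i.+1 _ _ Fr Ft)|rewrite mulrDr].
exists (p.1 * r); last by rewrite mulrCA.
exists [:: (p.1, r)]; last by rewrite big_seq1.
by move=> q; rewrite inE => /eqP ->.
Qed.

Lemma powmod_exp y n :
  (I : set R) y -> powmod I (self (whole R)) n (y ^+ n).
Proof.
move=> Iy; elim: n => [|n IH] //=.
exists [:: (y, y ^+ n)]; last by rewrite big_seq1 exprS.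
by move=> q; rewrite inE => /eqP ->.
Qed.

Lemma nonzerodivisorX (y : R) n : nonzerodivisor y -> nonzerodivisor (y ^+ n).
Proof.
move=> yreg; elim: n => [|n IH] z; first by rewrite mul1r.
by rewrite exprS -mulrA => /yreg/IH.
Qed.

Lemma reduction_nonzerodivisor :
  regular_ideal I -> reduction (principal x) I -> nonzerodivisor x.
Proof.
move=> [y Iy yreg] [_ [n In]] z xz.
have := @powmod_exp y n.+1 Iy; rewrite [powmod _ _ _]In => -[s hs E].
(* Since y^(n+1) is a non-zero-divisor, it suffices that z kills it; z kills each summand, a
   multiple of x. *)
apply: (@nonzerodivisorX y n.+1 yreg); rewrite E mulr_suml big_seq big1 //.
move=> p /hs[[b _ <-] _].
by rewrite -[x * b * _]mulrA mulrAC xz mul0r.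
Qed.

End PrincipalReduction.

Theorem proposition3p1 (R : comNzRingType) (m : ideal (whole R)) (k : subfield R)
    (I : ideal (whole R)) (x : R) :
  noetherian R -> local_ring m -> krull_dim R 1 -> cohen_macaulay m ->
  infinite_set (residue_field m) ->
  set_bij (k : set R) (residue_field m) (coset m) ->
  ~ (I : set R) 1 -> regular_ideal I ->
  minimal_reduction (principal x) I ->
  let U := coef_subring k I in
  let n := coef_ideal k I in
  let J := principal x in
  exists f : grmod I (self (whole R)) -> grmod I J, [/\ bijective f,
    forall i u, homogeneous i u -> homogeneous i (f u),
    linear (f : grmod n (restr U (self (whole R))) -> grmod n (restr U J)) &
    linear (f : grmod I (self (whole R)) -> grmod I J)].
Proof.
move=> _ _ _ _ _ _ _ Ireg [xred _] U n J.
have xreg := reduction_nonzerodivisor _ _ _ Ireg xred.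
have xFG := powmod_mulx R I x.
exists (gr_mulx _ _ _ _ _ _ xFG); split.
- by apply: (gr_mulx_bij _ _ _ _ _ _ xFG) => //; apply: powmod_principal.
- by move=> i u; apply: (gr_mulx_homogeneous _ _ _ _ _ _ xFG).
(* The ideals n and I have the same underlying set, so the filtrations over U and over R coincide by
   conversion and the same map is reused with scalars in gr_n(U). *)
- exact: (@gr_mulx_linear R U n (restr U (self (whole R))) (restr U J) x xFG).
- exact: (gr_mulx_linear _ _ _ _ _ _ xFG).
Qed.
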